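(* Let $n>1$ be an integer and let $D$ be a set of positive proper divisors of $n$ such that the integral circulant graph $ICG_n(D)$ is connected. Then every eigenvalue of the distance matrix of $ICG_n(D)$ is an integer.
   Context: For an integer $n>1$ and a set $D$ of positive proper divisors of $n$, the integral circulant graph $ICG_n(D)$ has vertex set $\mathbb{Z}_n=\{0,1,\dots,n-1\}$, and two distinct vertices $a,b$ are adjacent iff $\gcd(a-b,n)\in D$. The distance matrix of a connected graph on vertices $0,\dots,n-1$ is the $n\times n$ matrix whose $(i,j)$ entry is the length of a shortest path between $i$ and $j$. *)

(* Defs.v *)
From mathcomp Require Import all_boot all_order all_algebra all_field.

Set Implicit Arguments.
Unset Strict Implicit.
Unset Printing Implicit Defensive.

Import GRing.Theory.
Local Open Scope ring_scope.

Definition icg (n : nat) (D : {pred nat}) : rel 'I_n :=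
  fun a b => (a != b) && (gcdn `|a%:Z - b%:Z|%N n \in D).

Definition connected (T : finType) (e : rel T) : Prop :=
  forall x y : T, connect e x y.

Definition has_walk (T : finType) (e : rel T) (x y : T) (k : nat) : bool :=
  [exists p : k.-tuple T, path e x p && (last x p == y)].

(* Length of a shortest path from x to y. It suffices to search the lengths
   below #|T|, see gdistP; the value is #|T| if y is not reachable from x. *)
Definition gdist (T : finType) (e : rel T) (x y : T) : nat :=
  find (has_walk e x y) (iota 0 #|T|).

Lemma has_walkP (T : finType) (e : rel T) (x y : T) (k : nat) :
  reflect (exists p : seq T, [/\ path e x p, last x p = y & size p = k])
          (has_walk e x y k).
Proof.
apply: (iffP existsP) => [[p /andP[ep /eqP lp]]|[p [ep lp /eqP sp]]].
  by exists p; rewrite size_tuple.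
by exists (Tuple sp); rewrite /= ep lp eqxx.
Qed.

Lemma gdistP (T : finType) (e : rel T) (x y : T) :
  connect e x y ->
  (exists p : seq T, [/\ path e x p, last x p = y & size p = gdist e x y])
  /\ (forall p : seq T, path e x p -> last x p = y -> (gdist e x y <= size p)%N).
Proof.
case/connectP=> p0 ep0 ->{y}; set y := last x p0.
have short p : path e x p -> last x p = y ->
    exists2 k, (k <= size p)%N & (k < #|T|)%N && has_walk e x y k.
  move=> ep lp; case/shortenP: ep lp => q eq uq sq lq.
  exists (size q); first by apply: uniq_leq_size; first by case/andP: uq.
  apply/andP; split; last by apply/has_walkP; exists q.
  by rewrite -[(size q).+1]/(size (x :: q)) -(card_uniqP uq) max_card.
have min k : (k < #|T|)%N -> has_walk e x y k -> (gdist e x y <= k)%N.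
  move=> kT wk; rewrite leqNgt; apply/negP => /(before_find 0%N).
  by rewrite nth_iota // add0n wk.
split=> [|p ep lp]; last first.
  by have [k kp /andP[kT wk]] := short p ep lp; apply: leq_trans (min k kT wk) kp.
have [k _ /andP[kT wk]] := short p0 ep0 erefl.
apply/has_walkP; rewrite -[gdist e x y]add0n -(@nth_iota 0 0 #|T|).
  by apply: nth_find; apply/hasP; exists k; rewrite // mem_iota.
exact: leq_ltn_trans (min k kT wk) kT.
Qed.

Definition distance_mx (R : nzRingType) (n : nat) (e : rel 'I_n) : 'M[R]_n :=
  \matrix_(i, j) (gdist e i j)%:R.

(* Main.v *)
(* Translations and multiplications by units of Z_n are automorphisms of
   ICG_n(D), and every z is a unit multiple of gcd(z, n); hence the distance
   from i to j is a function of gcd(j - i, n) only. The characters of Z_n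
   therefore diagonalise the distance matrix, and its eigenvalues are integral
   combinations of the Ramanujan-type sums of w^(kz) over gcd(z, n) = d. These
   are integers by descending induction on d, because the full sum over the
   multiples of d is 0 or their number. *)
Require Import Defs.
From mathcomp Require Import all_boot all_order all_algebra all_field.

Set Implicit Arguments.
Unset Strict Implicit.
Unset Printing Implicit Defensive.

Import GRing.Theory Num.Theory.
Local Open Scope ring_scope.

Lemma gdist_aut (T : finType) (e : rel T) (f : T -> T) (x y : T) :
    bijective f -> {mono f : a b / e a b} ->
  gdist e (f x) (f y) = gdist e x y.
Proof.
move=> [g fK gK] fe; rewrite /gdist; apply: eq_find => k.
apply/has_walkP/has_walkP => -[p [ep lp sp]].
  exists (map g p); split; last by rewrite size_map.
    rewrite -[x]fK path_map; apply: sub_path ep => a b /=.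
    by rewrite -(fe (g a)) !gK.
  by rewrite -[x]fK last_map lp fK.
exists (map f p); split; last by rewrite size_map.
  by rewrite path_map; apply: sub_path ep => a b /=; rewrite fe.
by rewrite last_map lp.
Qed.

(** Serves to turn a Bezout coefficient, coprime only to a divisor of [n], into a unit of Z_n. *)
Lemma coprime_lift (n m u : nat) :
  (0 < n)%N -> (0 < u)%N -> coprime u m ->
  exists2 v, coprime v n & v = u %[mod m].
Proof.
(* The factor in front of [m] is the largest divisor of [n] coprime to [u], so each prime factor of
   [n] divides exactly one of the two summands. *)
move=> n_gt0 u_gt0 cum; exists (u + n`_(\pi(u)^') * m)%N; last first.
  by rewrite addnC modnMDl.
rewrite coprime_sym coprime_has_primes ?addn_gt0 ?u_gt0 //.
apply/hasPn => p; rewrite !mem_primes /= n_gt0 addn_gt0 u_gt0 /=.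
case/andP=> p_pr pv; rewrite p_pr /=; apply/negP => pn.
have [pu|pNu] := boolP (p %| u)%N.
  move: pv; rewrite dvdn_addr // Euclid_dvdM //; case/orP => [pt|pm].
    have := pnatP _ (part_gt0 _ n) (part_pnat \pi(u)^' n).
    by move=> /(_ p p_pr pt); rewrite !inE mem_primes p_pr u_gt0 pu.
  have := dvdn_gcd p u m; rewrite pu pm (eqP cum) dvdn1 => /eqP p1.
  by rewrite p1 in p_pr.
have pt : (p %| n`_(\pi(u)^'))%N.
  rewrite -(part_pnat_id (pi := \pi(u)^') (n := p)) ?partn_dvd //.
  by rewrite pnatE // !inE mem_primes p_pr u_gt0.
by move: pv; rewrite dvdn_addl ?(negPf pNu) // dvdn_mulr.
Qed.

(** With [g = gcdn z n], Bezout gives [k * z = l * n + g]. Dividing by [g] shows [k] coprime to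
    [n %/ g], and [k * z] modulo [n] depends only on [k] modulo [n %/ g], so [coprime_lift] may
    replace [k]. *)
Lemma coprime_mul_gcd (n z : nat) :
  (0 < n)%N -> exists2 v, coprime v n & (v * z = gcdn z n %[mod n])%N.
Proof.
move=> n_gt0; have [->|z_gt0] := posnP z.
  by exists 1%N; rewrite ?coprime1n // gcd0n modnn mod0n.
case: (egcdnP n z_gt0) => k l kz _.
have g_gt0 : (0 < gcdn z n)%N by rewrite gcdn_gt0 z_gt0.
have k_gt0 : (0 < k)%N.
  by have := ltn_addl (l * n) g_gt0; rewrite -kz muln_gt0 => /andP[].
have ck : coprime k (n %/ gcdn z n).
  rewrite /coprime -dvdn1.
  rewrite -(dvdn_addr 1 (dvdn_mull l (dvdn_gcdr k (n %/ gcdn z n)))).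
  have -> : (l * (n %/ gcdn z n) + 1 = k * (z %/ gcdn z n))%N.
    apply/eqP; rewrite -(eqn_pmul2r g_gt0) mulnDl mul1n -!mulnA.
    by rewrite !divnK ?dvdn_gcdl ?dvdn_gcdr // kz.
  by rewrite dvdn_mulr // dvdn_gcdl.
have [v cv vk] := coprime_lift n_gt0 k_gt0 ck; exists v => //.
have red m : (m * z %% n = m %% (n %/ gcdn z n) * z %% n)%N.
  rewrite {1}(divn_eq m (n %/ gcdn z n)) mulnDl -mulnA.
  by rewrite [(_ %/ _ * z)%N]mulnC muln_divCA_gcd mulnCA mulnC modnMDl.
by rewrite red vk -red kz modnMDl.
Qed.

Section Icg.

Variables (n' : nat) (D : {pred nat}).
Local Notation n := n'.+2.
Implicit Types x y z u : 'I_n.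

(** The integer difference and the subtraction of Z_n agree up to sign and a multiple of [n], which
    the gcd ignores. *)
Lemma gcdn_distn x y : gcdn `|x%:Z - y%:Z|%N n = gcdn (x - y)%R n.
Proof.
rewrite /= gcdn_modl -[RHS]gcdn_modl modnDmr [RHS]gcdn_modl.
have [le_yx|/ltnW le_xy] := leqP y x.
  rewrite subzn // absz_nat addnBA ?(ltnW (ltn_ord y)) // -addnBAC //.
  by rewrite gcdnC -gcdnDr gcdnC.
have -> : (x + (n - y) = n - (y - x))%N.
  by rewrite subnBA // addnC addnBAC // ltnW.
have le_n : (y - x <= n)%N by rewrite (leq_trans (leq_subr _ _)) // ltnW.
rewrite distnC subzn // absz_nat -[X in gcdn _ X = _](subnK le_n) gcdnDr.
by rewrite -[X in _ = gcdn _ X](subnK le_n) gcdnDl gcdnC.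
Qed.

Lemma icgE x y : icg D x y = (x != y) && (gcdn (x - y)%R n \in D).
Proof. by rewrite /icg gcdn_distn. Qed.

Lemma gdist_translate x y z : gdist (icg D) (x + z) (y + z) = gdist (icg D) x y.
Proof.
apply: (gdist_aut (f := fun t => t + z)) => [|a b].
  by exists (fun t => t - z) => t; rewrite ?addrK ?subrK.
by rewrite !icgE (inj_eq (addIr z)) opprD addrACA subrr addr0.
Qed.

Lemma gcdn_unit_mul u z : u \is a GRing.unit -> gcdn (u * z)%R n = gcdn z n.
Proof.
move=> Uu; have cu : coprime n u by rewrite -(@unitZpE n) // natr_Zp.
by rewrite /= gcdn_modl gcdnC Gauss_gcdr // gcdnC.
Qed.

Lemma gdist_unit_mul u x y :
  u \is a GRing.unit -> gdist (icg D) (u * x) (u * y) = gdist (icg D) x y.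
Proof.
move=> Uu; apply: (gdist_aut (f := *%R u)) => [|a b].
  by exists ( *%R u^-1) => t; rewrite ?mulKr ?mulVKr.
by rewrite !icgE (inj_eq (mulrI Uu)) -mulrBr gcdn_unit_mul.
Qed.

(** Multiplication by a suitable unit fixes 0 and sends [z] to its gcd with [n]. For [z = 0] that
    gcd is [n], which [inZp] maps back to 0. *)
Lemma gdist_gcd z :
  gdist (icg D) 0 z = gdist (icg D) 0 (inZp (gcdn z n) : 'I_n).
Proof.
have [v cv vz] := coprime_mul_gcd z (ltn0Sn n'.+1).
have Uv : (v%:R : 'I_n) \is a GRing.unit by rewrite (@unitZpE n) // coprime_sym.
rewrite -(gdist_unit_mul 0 z Uv) mulr0; congr (gdist _ _ _).
by apply: val_inj; rewrite /= (@val_Zp_nat n) // modnMml vz.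
Qed.

End Icg.

(** The gcd takes the value [n] at [z = 0], so gcd classes are indexed by ['I_n.+1]. *)
Lemma inord_gcdn z n :
  (0 < n)%N -> (inord (gcdn z n) : 'I_n.+1) = gcdn z n :> nat.
Proof. by move=> n_gt0; rewrite inordK // ltnS dvdn_leq ?dvdn_gcdr. Qed.

Section Characters.

Variables (n' : nat) (w : algC).
Local Notation n := n'.+2.
Hypothesis w_prim : n.-primitive_root w.

Lemma prim_exprD (x y : 'I_n) k :
  w ^+ (k * (x + y)%R) = w ^+ (k * x) * w ^+ (k * y).
Proof. by rewrite -exprD -mulnDr !(mulnC k) !exprM (prim_expr_mod w_prim).
Qed.

(** Translation by [d] permutes the multiples of [d] and scales the sum by [w ^+ (k * d)]; either
    this factor is 1, and so is every term, or the sum vanishes. *)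
Lemma sum_multiples_int d k :
  (d %| n)%N -> \sum_(z : 'I_n | (d %| z)%N) w ^+ (k * z) \is a Num.int.
Proof.
move=> dn; set S := \sum_(z | _) _.
have dmod m : (d %| m %% n)%N = (d %| m)%N by rewrite /dvdn modn_dvdm.
have wS : w ^+ (k * d) * S = S.
  rewrite {2}/S (reindex_inj (addrI (inZp d : 'I_n))) mulr_sumr.
  apply: eq_big => [z|z _]; first by rewrite /= dmod dvdn_addr ?dmod.
  by rewrite prim_exprD /= !(mulnC k) !exprM (prim_expr_mod w_prim).
have [w1|w1] := eqVneq (w ^+ (k * d)) 1.
  apply: rpred_sum => z /dvdnP[q ->].
  by rewrite mulnCA mulnC exprM w1 expr1n rpred1.
suff -> : S = 0 by rewrite rpred0.
apply/eqP; have /eqP := wS; rewrite -subr_eq0 -{2}[S]mul1r -mulrBl.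
by rewrite mulf_eq0 subr_eq0 (negPf w1).
Qed.

Lemma sum_gcd_int d k :
  (d %| n)%N -> \sum_(z : 'I_n | gcdn z n == d) w ^+ (k * z) \is a Num.int.
Proof.
have [m] := ubnP (n - d); elim: m d => // m IHm d lt_m dn.
have := sum_multiples_int k dn.
rewrite (bigID (fun z : 'I_n => gcdn z n == d)) /= => Sint.
rewrite -(addrK (\sum_(z : 'I_n | (d %| z)%N && (gcdn z n != d)) w ^+ (k * z))
                (\sum_(z | _) _)).
rewrite (eq_bigl (fun z : 'I_n => (d %| z)%N && (gcdn z n == d))); last first.
  by move=> z; case: eqP => [<-|]; rewrite ?dvdn_gcdl ?andbF.
apply: rpredB => //.
(* The other multiples of [d] are grouped by their gcd [e] with [n]; as [e > d], the induction
   hypothesis covers each group. *)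
rewrite (partition_big (fun z : 'I_n => inord (gcdn z n) : 'I_n.+1)
  (fun e : 'I_n.+1 => [&& (d %| e)%N, (e %| n)%N & e != d :> nat])); last first.
  move=> z /andP[dz gd]; rewrite inord_gcdn //.
  by rewrite dvdn_gcd dz dn dvdn_gcdr gd.
apply: rpred_sum => e /and3P[de en ne].
have lt_de : (d < e)%N.
  by rewrite ltn_neqAle eq_sym ne dvdn_leq // (dvdn_gt0 _ en).
rewrite (eq_bigl (fun z : 'I_n => gcdn z n == e)).
  apply: IHm => //; apply: leq_trans (_ : n - d <= _)%N; last by rewrite -ltnS.
  by rewrite ltn_sub2l // (leq_trans lt_de) // dvdn_leq.
move=> z; rewrite -val_eqE /= inord_gcdn //.
case: (gcdn z n =P e) => [ge|]; last by rewrite andbF.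
by rewrite ge ne (dvdn_trans de) // -ge dvdn_gcdl.
Qed.

Lemma sum_gcd_invariant_int (f : 'I_n -> nat) k :
    (forall z, f z = f (inZp (gcdn z n))) ->
  \sum_z (f z)%:R * w ^+ (k * z) \is a Num.int.
Proof.
move=> f_gcd.
rewrite (partition_big (fun z : 'I_n => inord (gcdn z n) : 'I_n.+1)
  (fun e : 'I_n.+1 => (e %| n)%N)) /=; last first.
  by move=> z _; rewrite inord_gcdn // ?dvdn_gcdr.
apply: rpred_sum => e en.
rewrite (eq_bigl (fun z : 'I_n => gcdn z n == e)); last first.
  by move=> z; rewrite -val_eqE /= inord_gcdn //.
rewrite (eq_bigr (fun z : 'I_n => (f (inZp e))%:R * w ^+ (k * z))); last first.
  by move=> z /eqP ge; rewrite f_gcd ge.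
by rewrite -mulr_sumr rpredM ?rpred_nat ?sum_gcd_int.
Qed.

(** The sums are the values at the [n] distinct powers of [w] of the polynomial with coefficients
    [v], whose degree is below [n]. *)
Lemma characters_separate (v : 'rV[algC]_n) :
  v != 0 -> exists k, \sum_i v 0 i * w ^+ (k * i) != 0.
Proof.
move=> v0.
have [/existsP[k vk]|] :=
  boolP [exists k : 'I_n, \sum_i v 0 i * w ^+ (k * i) != 0]; first by exists k.
rewrite negb_exists => /forallP v_orth; case/eqP: v0.
apply: (can_inj rVpolyK); rewrite linear0.
apply: (@roots_geq_poly_eq0 _ _ [seq w ^+ k | k : 'I_n <- enum 'I_n]).
- apply/allP => _ /mapP[k _ ->]; have := v_orth k.
  rewrite negbK /root => /eqP <-.
  rewrite /rVpoly horner_poly; apply/eqP; apply: eq_bigr => i _.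
  by rewrite valK exprM.
- rewrite map_inj_uniq ?enum_uniq // => i j /eqP.
  by rewrite (eq_prim_root_expr w_prim) !modn_small // => /eqP/val_inj.
by rewrite size_map size_enum_ord size_poly.
Qed.

End Characters.

Theorem theorem2 (n : nat) (D : {pred nat}) (n_gt1 : (1 < n)%N)
    (D_proper : forall d : nat, d \in D -> [&& (0 < d)%N, (d %| n)%N & (d < n)%N])
    (conn : connected (@icg n D)) (a : algC) :
  eigenvalue (distance_mx algC (@icg n D)) a -> a \is a Num.int.
Proof.
case: n n_gt1 {D_proper conn} => [|[|n']] // _ /eigenvalueP[v va v0].
have [w w_prim] := C_prim_root_exists (ltn0Sn n'.+1).
have [k vk] := characters_separate w_prim v0.
(* Pairing [v *m M = a *: v], with [M] the distance matrix, with a character not orthogonal to [v]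
   identifies [a] as a Fourier coefficient of the distance from 0. *)
suff -> : a = \sum_z (gdist (icg D) 0 z)%:R * w ^+ (k * (z : 'I_n'.+2)).
  by apply: sum_gcd_invariant_int => // z; apply: gdist_gcd.
apply: (mulIf vk); rewrite mulr_sumr.
transitivity (\sum_j (v *m distance_mx algC (icg D)) 0 j * w ^+ (k * j)).
  by apply: eq_bigr => j _; rewrite va mxE mulrA.
under eq_bigr => j _ do rewrite mxE mulr_suml.
rewrite exchange_big /= mulr_sumr; apply: eq_bigr => i _.
rewrite (reindex_inj (addIr i)) /= mulr_suml; apply: eq_bigr => z _.
rewrite mxE prim_exprD // -(gdist_translate _ 0 z i) add0r.
by rewrite !mulrA; congr (_ * _); rewrite [RHS]mulrAC [v 0 i * _]mulrC.
Qed.
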